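(* Let $p$ be a prime with $p\equiv 5$ or $11\pmod{12}$, and let $r$ be an integer with $1\le r\le p-1$ and $p\mid 3r+1$. Then for all integers $n\ge 0$ and all integers $k\ge j\ge 0$, \[ a_{p(k-j)+(p-4),\;pk+p}(pn+r)\equiv 0 \pmod p. \]
   Context: For positive integers $r,s$, $a_{r,s}(n)$ denotes the number of multicolored partitions of $n$ in which each even part may appear in one of $r$ colors and each odd part may appear in one of $s$ colors (copies of the same part size in different colors are distinct), with $a_{r,s}(0)=1$. Equivalently, for $|q|<1$, $\sum_{n\ge0}a_{r,s}(n)q^n = f_2^{s-r}/f_1^{s}$, where $f_m=\prod_{i\ge1}(1-q^{mi})$. *)

(* Defs.v *)
From mathcomp Require Import all_boot.

Set Implicit Arguments.
Unset Strict Implicit.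
Unset Printing Implicit Defensive.

Definition ncolors (r s m : nat) : nat := if odd m then s else r.

(* Coloured parts of size at most n: the first component i stands for the
   part size i.+1, so that sizes range over 1, ..., n; larger parts cannot
   occur in a partition of n. *)
Definition colored_part (r s n : nat) : finType :=
  {i : 'I_n & 'I_(ncolors r s i.+1)}.

Definition part_size (r s n : nat) (x : colored_part r s n) : nat := (tag x).+1.

(* A multicoloured partition of n is given by the multiplicity f x of each
   coloured part x; multiplicities in a partition of n are at most n. *)
Definition is_colored_partition (r s n : nat)
    (f : {ffun colored_part r s n -> 'I_n.+1}) : bool :=
  \sum_x f x * part_size x == n.

Definition num_colored_partitions (r s n : nat) : nat :=
  #|[set f : {ffun colored_part r s n -> 'I_n.+1} | is_colored_partition f]|.

(* Main.v *)
Require Import Defs.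
From mathcomp Require Import all_boot all_algebra finfield.
From mathcomp Require Import zify ring.

(** With q-series written f_m, the generating function is
    f_2^(pj+4) / f_1^(p(k+1)), which modulo p is f_2^4 times a p-th power, i.e. a
    series in q^p. So it suffices that the coefficient of q^m in f_1^4 vanishes
    modulo p whenever p divides 6m + 1. Write f_1^4 = f_1 * f_1^3 and expand f_1
    by Euler's pentagonal number theorem and f_1^3 by Jacobi's identity: the
    coefficient of q^m is a sum of terms +-v over solutions of
    24m + 4 = u^2 + 3 v^2. As -3 is not a square modulo p (p = 2 mod 3), p
    divides v in each of them. Power series are handled as polynomials modulo
    a power of 'X, and both classical identities come from finite versions
    proved by induction. *)

Set Implicit Arguments.
Unset Strict Implicit.
Unset Printing Implicit Defensive.

Import GRing.Theory.
Local Open Scope ring_scope.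

Definition tri (k : nat) : nat := 'C(k.+1, 2).
Opaque tri.

Lemma triS k : tri k.+1 = (tri k + k.+1)%N.
Proof. by rewrite [LHS]binS bin1 addnC. Qed.

Lemma tri_double k : (tri k * 2 = k * k.+1)%N.
Proof. by elim: k => // k IH; rewrite triS; lia. Qed.

Lemma leq_tri k : (k <= tri k)%N.
Proof. by elim: k => // k IH; rewrite triS; lia. Qed.

(** * Power series modulo ['X^N] and finite q-Pochhammer products *)

Section TruncatedSeries.
Variable F : fieldType.
Implicit Types p q : {poly F}.

Definition eqmodX (N : nat) p q : bool := 'X^N %| p - q.

Lemma eqmodX_coef N p q i : eqmodX N p q -> (i < N)%N -> p`_i = q`_i.
Proof.
move=> /dvdpP[u /eqP]; rewrite subr_eq => /eqP -> ltiN.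
by rewrite coefD coefMXn ltiN add0r.
Qed.

Lemma eqmodX_refl N p : eqmodX N p p.
Proof. by rewrite /eqmodX subrr dvdp0. Qed.

Lemma eqmodX_sym N p q : eqmodX N p q = eqmodX N q p.
Proof. by rewrite /eqmodX -opprB dvdpNr. Qed.

Lemma eqmodX_trans N p q s : eqmodX N p q -> eqmodX N q s -> eqmodX N p s.
Proof. by move=> ? ?; rewrite /eqmodX -(subrKA q) dvdp_add. Qed.

Lemma eqmodX_add N p q p' q' :
  eqmodX N p q -> eqmodX N p' q' -> eqmodX N (p + p') (q + q').
Proof. by move=> ? ?; rewrite /eqmodX opprD addrACA dvdp_add. Qed.

Lemma eqmodX_mul N p q p' q' :
  eqmodX N p q -> eqmodX N p' q' -> eqmodX N (p * p') (q * q').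
Proof.
move=> Hp Hq; rewrite /eqmodX.
have -> : p * p' - q * q' = (p - q) * p' + q * (p' - q') by ring.
by apply: dvdp_add; [exact: dvdp_mulr | exact: dvdp_mull].
Qed.

Lemma eqmodX_exp N p q e : eqmodX N p q -> eqmodX N (p ^+ e) (q ^+ e).
Proof.
by move=> H; elim: e => [|e IH]; rewrite ?eqmodX_refl // !exprS eqmodX_mul.
Qed.

Lemma eqmodX_sum N (I : Type) (r : seq I) (P : pred I) (f g : I -> {poly F}) :
  (forall i, P i -> eqmodX N (f i) (g i)) ->
  eqmodX N (\sum_(i <- r | P i) f i) (\sum_(i <- r | P i) g i).
Proof.
by move=> H; apply: (big_ind2 (eqmodX N)) => //;
  [exact: eqmodX_refl | move=> *; exact: eqmodX_add].
Qed.

Lemma eqmodX_prod N (I : Type) (r : seq I) (P : pred I) (f g : I -> {poly F}) :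
  (forall i, P i -> eqmodX N (f i) (g i)) ->
  eqmodX N (\prod_(i <- r | P i) f i) (\prod_(i <- r | P i) g i).
Proof.
by move=> H; apply: (big_ind2 (eqmodX N)) => //;
  [exact: eqmodX_refl | move=> *; exact: eqmodX_mul].
Qed.

Lemma eqmodX_Xn N M p q m :
  (N <= m + M)%N -> eqmodX M p q -> eqmodX N ('X^m * p) ('X^m * q).
Proof.
move=> leN H; rewrite /eqmodX -mulrBr.
by apply: dvdp_trans (dvdp_exp2l _ leN) _; rewrite exprD dvdp_mul.
Qed.

Lemma eqmodX_1BXn N m : (N <= m)%N -> eqmodX N (1 - 'X^m) 1.
Proof.
by move=> leN; rewrite /eqmodX addrC addKr dvdpNr dvdp_exp2l.
Qed.

Definition qpoch (n : nat) : {poly F} := \prod_(i < n) (1 - 'X^(i.+1)).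

Lemma qpoch0 : qpoch 0 = 1.
Proof. by rewrite /qpoch big_ord0. Qed.

Lemma qpochS n : qpoch n.+1 = qpoch n * (1 - 'X^(n.+1)).
Proof. by rewrite /qpoch big_ord_recr. Qed.

Lemma qpoch_stable m n : (m <= n)%N -> eqmodX m.+1 (qpoch n) (qpoch m).
Proof.
elim: n => [|n IH]; first by rewrite leqn0 => /eqP->; exact: eqmodX_refl.
rewrite leq_eqVlt => /predU1P[->|lt_mn]; first exact: eqmodX_refl.
rewrite qpochS -[qpoch m]mulr1 eqmodX_mul ?IH //.
exact: eqmodX_1BXn.
Qed.

Lemma coprime_Xn_qpoch N n : coprimep 'X^N (qpoch n).
Proof.
apply: coprimep_expl; elim: n => [|n IH]; first by rewrite qpoch0 coprimep1.
rewrite qpochS coprimepMr IH /=.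
have -> : 1 - 'X^(n.+1) = - ('X^n * 'X) + 1 :> {poly F} by rewrite exprSr addrC.
by rewrite -mulNr coprimep_addl_mul coprimep1.
Qed.

(** [qpoch n] has constant term 1, hence is a unit modulo ['X^N]. *)
Lemma eqmodX_cancel N n p q :
  eqmodX N (p * qpoch n) (q * qpoch n) -> eqmodX N p q.
Proof. by rewrite /eqmodX -mulrBl Gauss_dvdpl ?coprime_Xn_qpoch. Qed.

Definition qtail (k n : nat) : {poly F} := \prod_(k <= i < n) (1 - 'X^(i.+1)).

Lemma qpoch_tail k n : (k <= n)%N -> qpoch n = qpoch k * qtail k n.
Proof.
move=> le_kn; rewrite /qpoch /qtail -!(big_mkord xpredT (fun i => 1 - 'X^(i.+1))).
exact: big_cat_nat.
Qed.

Lemma qtail_mod k n : eqmodX k.+1 (qtail k n) 1.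
Proof.
rewrite /qtail big_nat; apply: (big_ind (fun f => eqmodX k.+1 f 1)).
- exact: eqmodX_refl.
- by move=> x y Hx Hy; rewrite -[1]mulr1 eqmodX_mul.
- by move=> i /andP[ki _]; apply: eqmodX_1BXn.
Qed.

(** * Euler's pentagonal number theorem *)

(* Shanks' finite form: this sum is exactly the truncated pentagonal series,
   while only its term [k = 0] matters modulo ['X^n.+1]. *)
Definition shanks (n : nat) : {poly F} :=
  \sum_(k < n.+1) (-1) ^+ k * qtail k n * 'X^(k * n + tri k).

(** Freeing the bound [m] from [n] lets induction telescope the sum; at [m = n] the right side is a
    single new pentagonal term. *)
Lemma shanks_telescope n m : (m <= n)%N ->
  \sum_(k < m.+1) (-1) ^+ k * qtail k n.+1 * 'X^(k * n.+1 + tri k)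
  - \sum_(k < m.+1) (-1) ^+ k * qtail k n * 'X^(k * n + tri k)
  = - ((-1) ^+ m * qtail m n * 'X^(m.+1 * n.+1 + tri m)).
Proof.
have qtailS k : (k <= n)%N -> qtail k n.+1 = qtail k n * (1 - 'X^(n.+1)).
  by move=> lekn; rewrite /qtail big_nat_recr.
elim: m => [_|m IH lt_mn].
  by rewrite !big_ord1 qtailS // !mul0n mul1n !addn0 !expr0; ring.
rewrite !(big_ord_recr m.+1) /= opprD addrACA IH 1?ltnW // qtailS //.
have -> : qtail m n = (1 - 'X^(m.+1)) * qtail m.+1 n.
  by rewrite /qtail big_ltn.
rewrite triS.
have -> : (m.+1 * n.+1 + (tri m + m.+1) = m.+1 * n + tri m + m.+1 + m.+1)%N by lia.
have -> : (m.+1 * n.+1 + tri m = m.+1 * n + tri m + m.+1)%N by lia.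
have -> : (m.+2 * n.+1 + (tri m + m.+1) =
           m.+1 * n + tri m + m.+1 + m.+1 + n.+1)%N by lia.
rewrite addnA; move: (m.+1 * n + tri m)%N => e.
by rewrite !exprD !(exprS (-1)); ring.
Qed.

Lemma shanksS n :
  shanks n.+1 = shanks n + (-1) ^+ n.+1 *
    ('X^(n.+1 * n + tri n + n.+1) + 'X^(n.+1 * n.+1 + tri n.+1)).
Proof.
rewrite {1}/shanks big_ord_recr /=.
have /eqP := shanks_telescope (leqnn n); rewrite subr_eq => /eqP ->.
rewrite -/(shanks n) /qtail !big_geq //.
have -> : (n.+1 * n.+1 + tri n = n.+1 * n + tri n + n.+1)%N by lia.
by rewrite exprS; ring.
Qed.

Lemma shanks_support n i :
  (shanks n)`_i != 0 -> exists u, (24 * i + 1 = u ^ 2)%N.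
Proof.
have sgnE m (f : {poly F}) : ((-1) ^+ m * f)`_i = (-1) ^+ m * f`_i.
  by rewrite -[in LHS]signr_odd -[in RHS]signr_odd !mulr_sign; case: odd; rewrite ?coefN.
elim: n => [|n IH].
  have -> : shanks 0 = 1.
    by rewrite /shanks big_ord1 /qtail big_geq // mulr1 /= expr0 mul1r.
  rewrite coef1.
  by case: (i =P 0%N) => [-> _|_]; [exists 1%N | rewrite eqxx].
rewrite shanksS coefD; have [->|/IH//] := eqVneq ((shanks n)`_i) 0.
rewrite add0r sgnE coefD !coefXn.
have := tri_double n; have := tri_double n.+1.
(* With N = n+1 the two exponents are N(3N-1)/2 and N(3N+1)/2, giving the squares of 6N-1 and
   6N+1. *)
case: (i =P _) => [-> _ H _|_]; first by exists (6 * n + 5)%N; rewrite expnS expn1; nia.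
case: (i =P _) => [-> H _ _|_]; first by exists (6 * n + 7)%N; rewrite expnS expn1; nia.
by rewrite addr0 mulr0 eqxx.
Qed.

Lemma qpoch_shanks n : eqmodX n.+1 (qpoch n) (shanks n).
Proof.
rewrite /shanks big_ord_recl /= /eqmodX mul0n mul1r mulr1.
have -> : qpoch n = qtail 0 n by rewrite /qtail /qpoch big_mkord.
rewrite opprD addrA subrr add0r dvdpNr.
apply: (big_ind (fun f => 'X^(n.+1) %| f)) => [||i _]; first exact: dvdp0.
  by move=> ? ? ? ?; apply: dvdp_add.
apply: dvdp_mull; apply: dvdp_exp2l; rewrite /bump /= triS; lia.
Qed.

Lemma qpoch_support n i : (i <= n)%N ->
  (qpoch n)`_i != 0 -> exists u, (24 * i + 1 = u ^ 2)%N.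
Proof.
by move=> le_in; rewrite (eqmodX_coef (qpoch_shanks n)) //; apply: shanks_support.
Qed.

(** * Jacobi's identity for the cube *)

(* [c k.-1] for [c] extended to negative indices by [c (-1 - k) = - c k]. *)
Definition odd_pred (c : nat -> {poly F}) (k : nat) : {poly F} :=
  if k is k'.+1 then c k' else - c 0%N.

(* Up to sign and a power of ['X], [jac n k] is the Gaussian binomial
   [2n+1 choose n-k]; the recurrence is multiplication of the finite triple
   product by (1 - z q^n)(1 - q^n / z), read on the coefficient of z^(k+1). *)
Fixpoint jac (n k : nat) : {poly F} :=
  if n is n'.+1 then
    (1 + 'X^n * 'X^n) * jac n' k - 'X^n * odd_pred (jac n') k - 'X^n * jac n' k.+1
  else (k == 0%N)%:R.

Lemma jac_gt n k : (n < k)%N -> jac n k = 0.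
Proof.
elim: n k => [|n IH] [|k] //= lt_nk.
by rewrite !IH ?mulr0 ?subrr //; lia.
Qed.

(** Summation by parts: 2k+1 has zero second difference, and the odd extension cancels the boundary
    term at 0. *)
Lemma sum_odd_laplacian (c : nat -> {poly F}) M :
  \sum_(k < M) (2 * k).+1%:R * (c k *+ 2 - odd_pred c k - c k.+1)
  = (2 * M).+1%:R * odd_pred c M - ((2 * M)%:R - 1) * c M.
Proof.
elim: M => [|M IH]; first by rewrite big_ord0 /=; ring.
by rewrite big_ord_recr /= IH; case: M {IH} => [|M] /=; ring.
Qed.

(** This is the derivative at z = 1 of the finite triple product, which contains the factor z - 1;
    z^(k+1) and z^(-k) have opposite coefficients, whence the weight 2k+1. *)
Lemma sum_jac n : \sum_(k < n.+1) (2 * k).+1%:R * jac n k = qpoch n ^+ 2.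
Proof.
elim: n => [|n IH]; first by rewrite big_ord1 qpoch0 expr1n mulr1.
(* Writing 1 + x^2 = (1 - x)^2 + 2x with x = ['X^(n.+1)] isolates a second difference in [k]. *)
transitivity (\sum_(k < n.+2) ((1 - 'X^(n.+1)) ^+ 2 * ((2 * k).+1%:R * jac n k)
   + 'X^(n.+1) * ((2 * k).+1%:R * (jac n k *+ 2 - odd_pred (jac n) k - jac n k.+1)))).
  by apply: eq_bigr => k _ /=; ring.
rewrite big_split /= -!mulr_sumr sum_odd_laplacian big_ord_recr /= IH.
by rewrite !jac_gt // qpochS; ring.
Qed.


Lemma jac_closed n k : (k <= n)%N ->
  jac n k * qpoch (n - k) * qpoch (n + k).+1
  = (-1) ^+ k * 'X^(tri k) * qpoch n.*2.+1.
Proof.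
elim: n k => [|n IH] k.
  by rewrite leqn0 => /eqP-> /=; rewrite qpoch0 !mul1r.
move=> le_kn.
(* [D] is the right side at [n], [Q] the denominator at [n.+1]. Each term of the recurrence times
   [Q] is a multiple of [D]; at indices beyond [n] both sides of [E1] and [E2] vanish. *)
pose D := (-1) ^+ k * 'X^(tri k) * qpoch n.*2.+1.
pose Q := qpoch (n.+1 - k) * qpoch (n + k).+2.
have E1 : jac n k * Q = D * (1 - 'X^(n.+1 - k)) * (1 - 'X^((n + k).+2)).
  move: le_kn; rewrite leq_eqVlt => /predU1P[->|le_kn].
    by rewrite jac_gt // subnn; ring.
  by rewrite /D -IH // /Q subSn // !qpochS; ring.
have E2 : jac n k.+1 * Q
    = - (D * ('X^(k.+1) - 'X^(n.+1)) * (1 - 'X^(n.+1 - k))).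
  have [le_nk|lt_kn] := leqP n k.
    rewrite jac_gt //; move: le_nk; rewrite leq_eqVlt => /predU1P[->|lt_nk].
      by ring.
    have -> : k = n.+1 by lia.
    by rewrite subnn; ring.
  have := IH _ lt_kn; rewrite triS exprD addnS (exprS (-1)) => e.
  rewrite /D /Q.
  have -> : 'X^(n.+1) = 'X^(k.+1) * 'X^((n - k.+1).+1) :> {poly F}.
    by rewrite -exprD; congr ('X^_); lia.
  have -> : (n.+1 - k = (n - k.+1).+2)%N by lia.
  rewrite (qpochS (n - k.+1).+1) (qpochS (n - k.+1)).
  transitivity (jac n k.+1 * qpoch (n - k.+1) * qpoch (n + k).+2
     * (1 - 'X^((n - k.+1).+1)) * (1 - 'X^((n - k.+1).+2))); first by ring.
  by rewrite e; ring.
(* The factor ['X^k] makes up for the step from [tri k.-1] to [tri k]. *)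
have E3 : 'X^k * odd_pred (jac n) k * Q
    = - (D * (1 - 'X^((n + k).+1)) * (1 - 'X^((n + k).+2))).
  clear E1 E2; case: k le_kn @D @Q => [|k] le_kn D Q /=.
    rewrite /D /Q -(IH 0%N) // !subn0 !addn0 !qpochS; ring.
  have := IH k le_kn; rewrite /D /Q subSS addnS triS exprD (exprS (-1)) !qpochS => e.
  transitivity ('X^(k.+1) * (jac n k * qpoch (n - k) * (qpoch (n + k) * (1 - 'X^((n + k).+1))))
    * (1 - 'X^((n + k).+2)) * (1 - 'X^((n + k).+3))); first by ring.
  by rewrite e; ring.
have -> : (n.+1 + k).+1 = (n + k).+2 by lia.
have -> : n.+1.*2.+1 = n.*2.+3 by lia.
rewrite -mulrA -/Q /= !mulrBl -[_ * jac n k * Q]mulrA E1.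
have -> : 'X^(n.+1) * jac n k.+1 * Q = 'X^(n.+1) * (jac n k.+1 * Q) by ring.
have -> : 'X^(n.+1) * odd_pred (jac n) k * Q
  = 'X^(n.+1 - k) * ('X^k * odd_pred (jac n) k * Q).
  by rewrite !mulrA -exprD subnK.
rewrite E2 E3 2!qpochS.
have -> : (-1) ^+ k * 'X^(tri k) * (qpoch n.*2.+1 * (1 - 'X^(n.*2.+2))
    * (1 - 'X^(n.*2.+3))) = D * (1 - 'X^(n.*2.+2)) * (1 - 'X^(n.*2.+3)).
  by rewrite /D; ring.
(* All remaining powers are written through a = ['X^(n.+1 - k)], b = ['X^((n + k).+1)] and ['X],
   leaving a polynomial identity. *)
have ab : 'X^(n.+1) * 'X^(n.+1) = 'X^(n.+1 - k) * 'X^((n + k).+1) :> {poly F}.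
  by rewrite -!exprD; congr ('X^_); lia.
have kb : 'X^(n.+1) * 'X^(k.+1) = 'X * 'X^((n + k).+1) :> {poly F}.
  by rewrite -exprS -!exprD; congr ('X^_); lia.
have -> : 'X^(n.*2.+3) = 'X * ('X^(n.+1) * 'X^(n.+1)) :> {poly F}.
  by rewrite -!exprD -exprS; congr ('X^_); lia.
have -> : 'X^(n.*2.+2) = 'X^(n.+1) * 'X^(n.+1) :> {poly F}.
  by rewrite -!exprD; congr ('X^_); lia.
have -> : 'X^(n.+1) * - (D * ('X^(k.+1) - 'X^(n.+1)) * (1 - 'X^(n.+1 - k)))
  = - (D * ('X^(n.+1) * 'X^(k.+1) - 'X^(n.+1) * 'X^(n.+1)) * (1 - 'X^(n.+1 - k))).
  by ring.
rewrite kb ab (exprS _ (n + k).+1).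
move: ('X^(n.+1 - k)) ('X^((n + k).+1)) => a b; ring.
Qed.

(* [qpoch n.*2.+1] and [qpoch (n + k).+1] both agree with [qpoch n] modulo
   ['X^n.+1], so the closed form loses them. *)
Lemma jac_mod n k : (k <= n)%N ->
  eqmodX n.+1 (jac n k * qpoch n) ((-1) ^+ k * 'X^(tri k)).
Proof.
move=> le_kn.
have H : eqmodX n.+1 (jac n k * qpoch (n - k)) ((-1) ^+ k * 'X^(tri k)).
  apply: (@eqmodX_cancel _ n).
  apply: (@eqmodX_trans _ _ (jac n k * qpoch (n - k) * qpoch (n + k).+1)).
    apply: eqmodX_mul; first exact: eqmodX_refl.
    by rewrite eqmodX_sym qpoch_stable //; lia.
  rewrite jac_closed //; apply: eqmodX_mul; first exact: eqmodX_refl.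
  by rewrite qpoch_stable //; lia.
rewrite (qpoch_tail (leq_subr k n)) mulrA.
apply: eqmodX_trans (eqmodX_mul H (eqmodX_refl _ _)) _.
rewrite -!mulrA; apply: eqmodX_mul; first exact: eqmodX_refl.
rewrite -{2}['X^_]mulr1; apply: eqmodX_Xn (qtail_mod _ _).
have := leq_tri k; lia.
Qed.

Lemma qpoch_cube n : eqmodX n.+1 (qpoch n ^+ 3)
  (\sum_(k < n.+1) (2 * k).+1%:R * ((-1) ^+ k * 'X^(tri k))).
Proof.
rewrite exprSr -sum_jac mulr_suml; apply: eqmodX_sum => k _.
by rewrite -mulrA eqmodX_mul ?eqmodX_refl // jac_mod // -ltnS.
Qed.

(** As 8 tri(k) + 1 = (2k+1)^2, v is Jacobi's weight itself, and it must survive in [F] for the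
    coefficient to do so. *)
Lemma qpoch_cube_support n i : (i <= n)%N -> (qpoch n ^+ 3)`_i != 0 ->
  exists2 v, (8 * i + 1 = v ^ 2)%N & v%:R != 0 :> F.
Proof.
move=> le_in; rewrite (eqmodX_coef (qpoch_cube n)) // coef_sum.
have [/existsP[k /andP[/eqP-> nz _]]|] :=
    boolP [exists k : 'I_n.+1, (i == tri k) && ((2 * k).+1%:R != 0 :> F)].
  exists (2 * k).+1 => //; have := tri_double k; rewrite expnS expn1; nia.
rewrite negb_exists => /forallP H; rewrite big1 ?eqxx // => k _.
rewrite -signr_odd.
have -> : (2 * k).+1%:R * ((-1) ^+ odd k * 'X^(tri k))
  = ((2 * k).+1%:R * (-1) ^+ odd k) *: 'X^(tri k) :> {poly F}.
  by rewrite -mul_polyC polyCM rmorph_nat rmorph_sign; ring.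
rewrite coefZ coefXn; have := H k; case: (i =P _) => _; last by rewrite mulr0.
by rewrite /= negbK => /eqP ->; rewrite !mul0r.
Qed.

(** A nonzero term of the convolution gives 24m + 4 = (24i + 1) + 3(8(m - i) + 1). *)
Lemma qpoch4_support n m : (m <= n)%N -> (qpoch n ^+ 4)`_m != 0 ->
  exists u v, (24 * m + 4 = u ^ 2 + 3 * v ^ 2)%N /\ v%:R != 0 :> F.
Proof.
move=> le_mn; rewrite exprS coefM => nz.
have [i /andP[nu nv]] : exists i : 'I_m.+1,
    ((qpoch n)`_i != 0) && ((qpoch n ^+ 3)`_(m - i) != 0).
  apply/existsP; apply: contra_neqT nz; rewrite negb_exists => /forallP H.
  apply: big1 => i _; apply/eqP; rewrite mulf_eq0.
  by have := H i; rewrite negb_and !negbK.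
have le_im : (i <= m)%N by rewrite -ltnS.
have [u Hu] := qpoch_support (leq_trans le_im le_mn) nu.
have [v Hv nzv] := qpoch_cube_support (leq_trans (leq_subr _ _) le_mn) nv.
by exists u, v; split=> //; rewrite -Hu -Hv; lia.
Qed.

End TruncatedSeries.

(** * Generating functions of coloured partitions *)

Definition geom (R : nzRingType) (N i : nat) : {poly R} :=
  \sum_(m < N.+1) 'X^(m * i).

(** Distributivity turns the product over coloured parts into a sum over multiplicity functions,
    each contributing ['X] to its weight. *)
Lemma num_colored_partitions_coef (R : comNzRingType) r s n :
  (num_colored_partitions r s n)%:R
  = (\prod_(i < n) geom R n i.+1 ^+ ncolors r s i.+1)`_n.
Proof.
have -> : \prod_(i < n) geom R n i.+1 ^+ ncolors r s i.+1
  = \prod_(x : colored_part r s n) geom R n (part_size x).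
  rewrite -(@sig_big_dep _ _ _ 'I_n (fun i => 'I_(ncolors r s i.+1)) xpredT
    (fun _ => xpredT) (fun i _ => geom R n i.+1)) /=.
  by apply: eq_bigr => i _; rewrite prodr_const card_ord.
rewrite /geom bigA_distr_bigA /= coef_sum /num_colored_partitions -sum1_card.
rewrite natr_sum big_mkcond /=; apply: eq_bigr => f _.
rewrite -expr_sum coefXn inE /is_colored_partition eq_sym.
by case: eqP.
Qed.

Lemma geom_mul1B (F : fieldType) N i : (0 < i)%N ->
  eqmodX N.+1 (geom F N i * (1 - 'X^i)) 1.
Proof.
move=> i_gt0; rewrite /geom.
have -> : (\sum_(m < N.+1) 'X^(m * i)) * (1 - 'X^i) = 1 - 'X^(N.+1 * i) :> {poly F}.
  elim: N => [|N IH]; first by rewrite big_ord1 mul0n mul1n mul1r.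
  by rewrite big_ord_recr /= mulrDl IH (mulSn N.+1) exprD; ring.
by apply: eqmodX_1BXn; rewrite leq_pmulr.
Qed.

(** Index [i] stands for the part [i.+1], so odd indices are even parts. *)
Lemma prod_even_parts (R : comNzRingType) (g : nat -> R) N :
  \prod_(i < N | odd i) g i.+1 = \prod_(i < N./2) g (2 * i.+1)%N.
Proof.
elim: N => [|N IH]; first by rewrite !big_ord0.
rewrite big_mkcond big_ord_recr -big_mkcond /= IH uphalf_half.
case: (boolP (odd N)) => oddN; last by rewrite add0n mulr1.
rewrite add1n big_ord_recr /=; congr (_ * g _).
by rewrite -[in LHS](odd_double_half N) oddN; lia.
Qed.

(** * Reduction modulo p *)

Lemma coef_expp (F : fieldType) p (W : {poly F}) i :
  p \in [pchar F] -> (W ^+ p)`_i != 0 -> (p %| i)%N.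
Proof.
move=> pF; have pP : p \in [pchar {poly F}] by rewrite pchar_poly.
rewrite -(pFrobenius_autE pP) -[W]coefK poly_def rmorph_sum coef_sum.
apply: contraR => ndvd; apply/eqP; apply: big1 => k _.
rewrite /= pFrobenius_autE exprZn -exprM coefZ coefXn.
case: (i =P _) => [ei|_]; last by rewrite mulr0.
by rewrite ei dvdn_mull in ndvd.
Qed.

(* Since 3 does not divide p - 1, the field with p elements has no primitive
   cube root of unity, hence no square root of -3. *)
Lemma Fp_sqrtN3 p (u v : nat) : prime p -> (p %% 3 = 2)%N -> odd p ->
  (p %| u ^ 2 + 3 * v ^ 2)%N -> (p %| v)%N.
Proof.
move=> p_pr p3 p_odd dvd.
have pF : p \in [pchar 'F_p] by exact: pchar_Fp.
rewrite (dvdn_pcharf pF); apply/negPn/negP => nzv.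
have : (u%:R ^+ 2 + 3%:R * v%:R ^+ 2 == 0 :> 'F_p).
  by rewrite -!natrX -natrM -natrD -(dvdn_pcharf pF).
move/eqP; move: nzv; set V : 'F_p := v%:R; set U : 'F_p := u%:R => nzV eqUV.
have nz2 : 2%:R != 0 :> 'F_p.
  rewrite -(dvdn_pcharf pF) (dvdn_prime2 p_pr) //; apply/negP => /eqP p_eq2.
  by rewrite p_eq2 in p_odd.
have nz3 : 3%:R != 0 :> 'F_p.
  rewrite -(dvdn_pcharf pF) (dvdn_prime2 p_pr) //; apply/negP => /eqP p_eq3.
  by rewrite p_eq3 in p3.
(* [U / V] is a square root of -3, so [w] is a root of x^2 + x + 1. *)
pose w := (U / V - 1) / 2%:R.
have w2 : w ^+ 2 + w + 1 = 0.
  suff : (w ^+ 2 + w + 1) * (4%:R * V ^+ 2) = 0.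
    move/eqP; rewrite mulf_eq0 => /orP[/eqP//|].
    rewrite mulf_eq0 expf_eq0 (negPf nzV) andbF orbF.
    by rewrite (natrM _ 2 2) mulf_eq0 (negPf nz2).
  rewrite -[RHS]eqUV /w; field; exact/andP.
have w3 : w ^+ 3 = 1.
  by apply/eqP; rewrite -subr_eq0; apply/eqP; rewrite -[RHS](mulr0 (w - 1)) -w2; ring.
have nzw : w != 0.
  by apply/eqP => w0; move/eqP: w3; rewrite w0 expr0n /= eq_sym oner_eq0.
have wp : w ^+ p = w by rewrite -[in X in _ ^+ X](card_Fp p_pr) expf_card.
(* Fermat gives w^p = w, while p = 2 mod 3 gives w^p = w^2. *)
have w1 : w = 1.
  apply: (mulfI nzw); rewrite mulr1 -expr2 -[RHS]wp.
  have -> : w ^+ p = w ^+ (3 * (p %/ 3) + 2).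
    by congr (_ ^+ _); rewrite [LHS](divn_eq p 3) p3 mulnC.
  by rewrite exprD exprM w3 expr1n mul1r.
have e3 : 3%:R = w ^+ 2 + w + 1 by rewrite w1; ring.
by rewrite e3 w2 eqxx in nz3.
Qed.

(** The product is [qpoch] evaluated at ['X^2], so only M = 2m matters, and then 24m + 4 = 4(3M + 1)
    is divisible by p. *)
Lemma even_qpoch4_coef p L M : prime p -> (p %% 3 = 2)%N -> odd p ->
  (p %| 3 * M + 1)%N -> (M <= L.*2.+1)%N ->
  ((\prod_(i < L) (1 - 'X^(2 * i.+1))) ^+ 4 : {poly 'F_p})`_M = 0.
Proof.
move=> p_pr p3 p_odd dvdM leM.
have -> : (\prod_(i < L) (1 - 'X^(2 * i.+1))) ^+ 4
    = (qpoch 'F_p L ^+ 4) \Po 'X^2 :> {poly 'F_p}.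
  rewrite rmorphXn /qpoch rmorph_prod; congr (_ ^+ 4); apply: eq_bigr => i _ /=.
  by rewrite rmorphB rmorphXn /= comp_polyX -exprM rmorph1.
rewrite coef_comp_poly_Xn //; case: ifP => // /dvdnP[m eM].
rewrite {}eM in dvdM leM *; rewrite mulnK //.
apply/eqP/negPn/negP => nz; have lemL : (m <= L)%N by lia.
have [u [v [e]]] := qpoch4_support lemL nz.
rewrite -(dvdn_pcharf (pchar_Fp p_pr)) => /negP; apply.
apply: (Fp_sqrtN3 (u := u)) => //; rewrite -e.
have -> : (24 * m + 4 = 4 * (3 * (m * 2) + 1))%N by lia.
exact: dvdn_mull.
Qed.

(** Odd parts carry the exponent p(k+1), already a multiple of p. Even parts carry p(l+1) - 4; the
    four extra geometric factors put into [W] are cancelled by (1 - x^i)^4. *)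
Lemma colored_gf_factor (F : fieldType) p k l N : (4 <= p)%N ->
  exists W : {poly F}, eqmodX N.+1
    (\prod_(i < N) geom F N i.+1 ^+ ncolors (p * l + (p - 4)) (p * k + p) i.+1)
    (W ^+ p * (\prod_(i < N./2) (1 - 'X^(2 * i.+1))) ^+ 4).
Proof.
move=> p_ge4.
exists (\prod_(i < N) geom F N i.+1 ^+ (if odd i then l else k).+1).
rewrite -(prod_even_parts (fun i => 1 - 'X^i)) [X in _ * X ^+ 4]big_mkcond.
rewrite -!prodrXl -big_split.
apply: eqmodX_prod => i _ /=; rewrite /ncolors /= -exprM.
case: (odd i) => /=; last first.
  by rewrite expr1n mulr1 mulSn addnC mulnC; exact: eqmodX_refl.
have -> : (l.+1 * p = p * l + (p - 4) + 4)%N by lia.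
move: (p * l + (p - 4))%N => e.
rewrite exprD -[X in eqmodX _ X _]mulr1 -mulrA -exprMn.
apply: eqmodX_mul; first exact: eqmodX_refl.
by rewrite eqmodX_sym -{2}(expr1n _ 4) eqmodX_exp // geom_mul1B.
Qed.

Local Close Scope ring_scope.

Theorem theorem1p12 (p r n k j : nat)
    (p_prime : prime p)
    (p_mod12 : p = 5 %[mod 12] \/ p = 11 %[mod 12])
    (r_bounds : 1 <= r <= p - 1)
    (p_dvd : p %| 3 * r + 1)
    (le_jk : j <= k) :
  num_colored_partitions (p * (k - j) + (p - 4)) (p * k + p) (p * n + r)
    = 0 %[mod p].
Proof.
have p3 : p %% 3 = 2 by lia.
have p_odd : odd p by lia.
have p_ge4 : 4 <= p by lia.
have pF := pchar_Fp p_prime.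
rewrite mod0n; apply/eqP; rewrite -[_ == _]/(p %| _) (dvdn_pcharf pF).
rewrite num_colored_partitions_coef; set N := p * n + r.
have [W GE] := colored_gf_factor 'F_p k (k - j) N p_ge4.
rewrite (eqmodX_coef GE) // coefM; apply/eqP; apply: big1 => i _.
have [->|/(coef_expp pF) /dvdnP[t et]] := eqVneq ((W ^+ p)`_i)%R 0%R.
  by rewrite mul0r.
have le_iN : i <= N by rewrite -ltnS.
rewrite even_qpoch4_coef ?mulr0 //.
  (* Here i = pt, so 3(N - i) + 1 agrees with 3r + 1 modulo p; adding 3pt avoids the truncated
     subtraction. *)
  have : p %| 3 * (N - i) + 1 + p * (3 * t).
    have -> : 3 * (N - i) + 1 + p * (3 * t) = p * (3 * n) + (3 * r + 1).
      by move: (subnKC le_iN); rewrite et {2}/N; nia.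
    by rewrite dvdn_addr // dvdn_mulr.
  by rewrite dvdn_addl // dvdn_mulr.
by have := odd_double_half N; have := leq_b1 (odd N); lia.
Qed.
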